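(* Let $1\le i\le n$ and let $\underline\ell=(i-1\le\ell_1\le\dots\le\ell_i\le n)$ be an ascending sequence of integers. Then the polytopes $\mathcal O_{\underline\ell}$ and $\mathcal C_{\underline\ell}$ are both normal.
   Context: $\mathcal P_{\underline\ell}$ is the poset with elements $x_{k,j}$, $1\le k\le i$, $i\le j\le\ell_k$, and $x_{k_1,j_1}\ge x_{k_2,j_2}$ iff $k_1\le k_2$ and $j_1\ge j_2$. Let $N$ be its number of elements. The order polytope and chain polytope are $$\mathcal O_{\underline\ell}=\{(s_{k,j})\in\mathbb R_{\ge0}^N\mid s_{k,j}\le1\ \forall k,j,\ \ s_{k_1,j_1}\ge s_{k_2,j_2}\text{ if }x_{k_1,j_1}>x_{k_2,j_2}\},$$ $$\mathcal C_{\underline\ell}=\Big\{(s_{k,j})\in\mathbb R_{\ge0}^N\,\Big|\,\textstyle\sum_p s_{k_p,j_p}\le1\text{ for all chains }x_{k_1,j_1}>\dots>x_{k_s,j_s}\Big\}.$$ A lattice polytope $P\subset\mathbb R^N$ is normal if for all $m\ge1$ and all $p\in mP\cap\mathbb Z^N$ there are $p_1,\dots,p_m\in P\cap\mathbb Z^N$ with $p=p_1+\dots+p_m$. *)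

(* Defs.v *)
From HB Require Import structures.
From mathcomp Require Import all_boot all_order all_algebra archimedean.
From mathcomp Require Import classical_sets reals.

Set Implicit Arguments.
Unset Strict Implicit.
Unset Printing Implicit Defensive.

Import Order.TTheory GRing.Theory Num.Theory.
Local Open Scope classical_set_scope.
Local Open Scope ring_scope.

(** The coordinate space R^N is modelled as [{ffun I -> R^o}] with [I] a finite
    index type of cardinal N; [R^o] is [R] seen as a module over itself, which
    gives the pointwise scaling [*:]. *)
Section Polytopes.
Variables (R : realType) (I : finType).
Implicit Types (P : set {ffun I -> R^o}) (p : {ffun I -> R^o}).

Definition lattice_point p : Prop := forall x, p x \is a Num.int.

Definition dilate (m : nat) P : set {ffun I -> R^o} :=
  [set m%:R *: q | q in P].

Definition conv_hull (s : seq {ffun I -> R^o}) : set {ffun I -> R^o} :=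
  [set p : {ffun I -> R^o} | exists a : 'I_(size s) -> R,
     [/\ forall k, 0 <= a k, \sum_k a k = 1
       & p = \sum_k a k *: tnth (in_tuple s) k]].

Definition lattice_polytope P : Prop :=
  exists s : seq {ffun I -> R^o},
    (forall v, v \in s -> lattice_point v) /\ P = conv_hull s.

(** Normality is a property of lattice polytopes, hence the first conjunct. *)
Definition normal_polytope P : Prop :=
  lattice_polytope P /\
  forall m : nat, (1 <= m)%N ->
  forall p, dilate m P p -> lattice_point p ->
  exists q : 'I_m -> {ffun I -> R^o},
    (forall k, P (q k) /\ lattice_point (q k)) /\ p = \sum_k q k.

End Polytopes.

Section PosetPolytopes.
Variables (R : realType) (d : Order.disp_t) (T : finPOrderType d).

Definition order_polytope : set {ffun T -> R^o} :=
  [set s : {ffun T -> R^o} | [/\ forall x, 0 <= s x, forall x, s x <= 1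
             & forall x y : T, (x > y)%O -> s x >= s y]].

Definition chain_polytope : set {ffun T -> R^o} :=
  [set s : {ffun T -> R^o} | (forall x, 0 <= s x) /\
     forall c : seq T, sorted >%O c -> \sum_(x <- c) s x <= 1].

End PosetPolytopes.

Arguments order_polytope R {d} T.
Arguments chain_polytope R {d} T.

(** The pair [(k, j)] stands for x_{k+1,j}: the row index is shifted by one, so
    that [tnth ell k] is l_{k+1}; the column index is not shifted. The bound [n]
    on columns is harmless as soon as all entries of [ell] are at most [n]. *)
Record poset_ell (n i : nat) (ell : i.-tuple nat) := PosetEll {
  row_col : 'I_i * 'I_n.+1;
  row_colP : (i <= row_col.2 <= tnth ell row_col.1)%N }.

Section PosetEll.
Variables (n i : nat) (ell : i.-tuple nat).

HB.instance Definition _ := [isSub for @row_col n i ell].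
HB.instance Definition _ := [Finite of poset_ell n ell by <:].

Definition poset_ell_le (x y : poset_ell n ell) : bool :=
  ((row_col y).1 <= (row_col x).1)%N && ((row_col x).2 <= (row_col y).2)%N.

Fact poset_ell_le_refl : reflexive poset_ell_le.
Proof. by move=> x; rewrite /poset_ell_le !leqnn. Qed.

Fact poset_ell_le_anti : antisymmetric poset_ell_le.
Proof.
move=> x y /andP[/andP[a b] /andP[c e]]; apply/val_inj => /=.
rewrite [row_col x]surjective_pairing [row_col y]surjective_pairing.
by congr pair; apply/val_inj/eqP; rewrite eqn_leq ?a ?b ?c ?e.
Qed.

Fact poset_ell_le_trans : transitive poset_ell_le.
Proof.
move=> y x z /andP[a b] /andP[c e]; apply/andP; split.
  exact: leq_trans c a.
exact: leq_trans b e.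
Qed.

Fact poset_ell_display : Order.disp_t. Proof. exact: (Order.Disp tt tt). Qed.

HB.instance Definition _ := Order.Le_isPOrder.Build poset_ell_display
  (poset_ell n ell) poset_ell_le_refl poset_ell_le_anti poset_ell_le_trans.

End PosetEll.

(* Main.v *)
Require Import Defs.
From mathcomp Require Import all_boot all_order all_algebra archimedean.
From mathcomp Require Import boolp classical_sets reals.

(** The order and chain polytopes of any finite poset [T] are normal, by a
    layer-cake formula. A point [q] of the order polytope is the integral over
    [t] in [0, 1] of the indicators of the filters [{x | 0 < t <= q x}]. For a
    point [q] of the chain polytope let [g x] be the largest weight of a chain
    strictly below [x]; then [q] is the integral of the indicators of
    [{x | g x < t <= g x + q x}], and these sets are antichains: if [y < x],
    then a chain below [y] can be prolonged by [y] to a chain below [x], so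
    [g y + q y <= g x] and the intervals of [y] and [x] are disjoint. The
    indicators of filters and of antichains are precisely the lattice points
    of the two polytopes.

    The integrand only jumps at the values of [g] and [g + q], so the integral
    is a finite sum over any subdivision that contains them
    ([layer_decomposition]). Subdividing by those values themselves exhibits
    [q] as a convex combination of 0/1 points. If moreover [m *: q] is
    integral, then so are [m * g x] and [m * (g x + q x)], because [g x] is a
    sum of coordinates of [q]; subdividing by the multiples of [1/m] then
    writes [m *: q] as a sum of [m] lattice points. [normal_of_layers] packages
    the two conclusions. *)

Set Implicit Arguments.
Unset Strict Implicit.
Unset Printing Implicit Defensive.

Import Order.TTheory GRing.Theory Num.Theory.
Local Open Scope classical_set_scope.
Local Open Scope ring_scope.

Section Layers.
Variables (R : realType) (I : finType).
Implicit Types (P : set {ffun I -> R^o}) (q v : {ffun I -> R^o}) (g : I -> R).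

Definition layer g q (t : R) : {ffun I -> R^o} :=
  [ffun x => (g x < t <= g x + q x)%R%:R].

Lemma lattice_point_layer g q t : lattice_point (layer g q t).
Proof. by move=> x; rewrite ffunE natr_int. Qed.

(** The steps up to the index [j] telescope; later ones that still satisfy
    [t k.+1 <= t j] have length zero. *)
Lemma layer_cake (t : nat -> R) (n j : nat) :
  (forall a b, (a <= b <= n)%N -> t a <= t b) -> (j <= n)%N ->
  \sum_(k < n) (t k.+1 - t k) * (t k.+1 <= t j)%R%:R = t j - t 0.
Proof.
move=> t_mono le_jn.
rewrite -(big_mkord xpredT (fun k => (t k.+1 - t k) * (t k.+1 <= t j)%R%:R)).
rewrite (big_cat_nat (n := j)) //= [X in _ + X]big_nat_cond [X in _ + X]big1 ?addr0.
  rewrite -(telescope_sumr t (leq0n j)).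
  by apply: eq_big_nat => k /andP[_ lt_kj]; rewrite t_mono ?lt_kj ?mulr1.
move=> k /andP[/andP[le_jk lt_kn] _].
case: (lerP (t k.+1) (t j)) => [le_t|]; last by rewrite mulr0.
rewrite mulr1; apply/eqP; rewrite subr_eq0 eq_le.
rewrite (le_trans le_t) ?t_mono ?le_jk ?(ltnW lt_kn) //=.
by rewrite leqnSn.
Qed.

Lemma layer_decomposition (t : nat -> R) (n : nat) g q :
  (forall a b, (a <= b <= n)%N -> t a <= t b) ->
  (forall x, 0 <= q x) ->
  (forall x, exists2 j, (j <= n)%N & g x = t j) ->
  (forall x, exists2 j, (j <= n)%N & g x + q x = t j) ->
  q = \sum_(k < n) (t k.+1 - t k) *: layer g q (t k.+1).
Proof.
move=> t_mono q_ge0 g_t h_t; apply/ffunP => x; rewrite sum_ffunE.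
have [j le_jn gE] := g_t x; have [j' le_j'n hE] := h_t x.
transitivity ((t j' - t 0%N) - (t j - t 0%N)).
  by rewrite -gE -hE opprB addrA subrK addrAC subrr add0r.
rewrite -!(layer_cake t_mono) // -sumrB; apply: eq_bigr => k _.
rewrite !ffunE -gE -hE -mulrBr; congr (_ * _).
have le_gh : g x <= g x + q x by rewrite lerDl.
case: ltP => [lt_gt|le_tg] /=; first by rewrite subr0.
by rewrite (le_trans le_tg le_gh) subrr.
Qed.

Lemma breakpoints (s : seq R) :
  (forall u, u \in s -> 0 <= u <= 1) ->
  exists (n : nat) (t : nat -> R),
    [/\ forall a b, (a <= b <= n)%N -> t a <= t b, t 0%N = 0, t n = 1
      & forall u, u \in s -> exists2 j, (j <= n)%N & u = t j].
Proof.
move=> s01; pose s' := sort <=%R [:: 0, 1 & s].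
have s'E u : (u \in s') = (u \in [:: 0, 1 & s]) by rewrite mem_sort.
have szE : size s' = (size s).+2 by rewrite size_sort.
have s'01 u : u \in s' -> 0 <= u <= 1.
  by rewrite s'E !inE => /or3P[/eqP->|/eqP->|/s01//]; rewrite ?lexx ?ler01.
have t_mono a b : (a <= b <= (size s).+1)%N -> nth 0 s' a <= nth 0 s' b.
  case/andP=> le_ab le_b; apply: (sorted_leq_nth le_trans lexx) => //.
  - exact/sort_sorted/le_total.
  - by rewrite inE szE ltnS (leq_trans le_ab).
  - by rewrite inE szE ltnS.
have t_onto u : u \in s' -> exists2 j, (j <= (size s).+1)%N & u = nth 0 s' j.
  by move=> us; exists (index u s'); rewrite ?nth_index // -ltnS -szE index_mem.
have t01 k : (k <= (size s).+1)%N -> 0 <= nth 0 s' k <= 1.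
  by move=> le_k; apply/s'01/mem_nth; rewrite szE ltnS.
exists (size s).+1, (nth 0 s'); split=> //.
- have [|j le_j z_j] := t_onto 0; first by rewrite s'E !inE eqxx.
  by apply/le_anti; rewrite (andP (t01 0%N isT)).1 andbT {2}z_j t_mono.
- have [|j le_j o_j] := t_onto 1; first by rewrite s'E !inE eqxx orbT.
  apply/eqP; rewrite eq_le (andP (t01 _ (leqnn _))).2 /=.
  by rewrite {1}o_j t_mono ?le_j ?leqnn.
- by move=> u us; apply: t_onto; rewrite s'E !inE us !orbT.
Qed.

(** Collects the weights of equal points, since [conv_hull] asks for exactly
    one weight per entry of the list. *)
Lemma conv_hull_comb (s : seq {ffun I -> R^o}) n (a : 'I_n -> R)
    (v : 'I_n -> {ffun I -> R^o}) :
  (forall k, 0 <= a k) -> \sum_k a k = 1 -> (forall k, v k \in s) ->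
  conv_hull s (\sum_k a k *: v k).
Proof.
move=> a_ge0 a_sum v_s.
have lt_index k : (index (v k) s < size s)%N by rewrite index_mem.
pose pos k := Ordinal (lt_index k).
exists (fun j => \sum_(k | pos k == j) a k); split.
- by move=> j; apply: sumr_ge0 => k _.
- by rewrite -a_sum [RHS](partition_big pos predT).
- rewrite (partition_big pos predT) //=; apply: eq_bigr => j _.
  rewrite scaler_suml; apply: eq_bigr => k /eqP <-.
  by rewrite (tnth_nth 0) /= nth_index.
Qed.

(** In the last hypothesis [lo x] is a list of indices, not a number, so that
    the lower end [g x] of the interval of [x] is an integral combination of
    the coordinates of [q]: this keeps it integral in the dilates of [P]. *)
Lemma normal_of_layers P :
  (forall n (a : 'I_n -> R) (v : 'I_n -> {ffun I -> R^o}),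
     (forall k, 0 <= a k) -> \sum_k a k = 1 -> (forall k, P (v k)) ->
     P (\sum_k a k *: v k)) ->
  (forall q, P q -> forall x, 0 <= q x) ->
  (forall q, P q -> exists lo : I -> seq I,
     let g x : R := \sum_(y <- lo x) q y in
     (forall x, g x + q x <= 1) /\ (forall t, P (layer g q t))) ->
  normal_polytope P.
Proof.
move=> P_conv P_ge0 P_layers; split.
  pose chi (A : {set I}) : {ffun I -> R^o} := [ffun x => (x \in A)%:R].
  pose s := [seq v <- [seq chi A | A : {set I}] | `[< P v >]].
  exists s; split.
    move=> v; rewrite mem_filter => /andP[_ /mapP[A _ ->]] x.
    by rewrite ffunE natr_int.
  apply/seteqP; split=> [q Pq|q [a [a_ge0 a_sum ->]]]; last first.
    apply: P_conv => // k; have := mem_tnth k (in_tuple s).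
    by rewrite mem_filter => /andP[/asboolP].
  have [lo] := P_layers q Pq; set g := fun x => _ => -[h_le1 P_layer].
  have q_ge0 := P_ge0 q Pq.
  have g_ge0 x : 0 <= g x by apply: sumr_ge0.
  pose vals := [seq g x | x : I] ++ [seq g x + q x | x : I].
  have [|n [t [t_mono t0 tn t_onto]]] := breakpoints (s := vals).
    move=> u; rewrite mem_cat => /orP[] /mapP[x _ ->].
      by rewrite g_ge0 (le_trans _ (h_le1 x)) ?lerDl.
    by rewrite h_le1 addr_ge0.
  rewrite (layer_decomposition t_mono q_ge0 (g := g)).
  - apply: conv_hull_comb => [k||k].
    + by rewrite subr_ge0 t_mono // leqnSn ltn_ord.
    + rewrite -(big_mkord xpredT (fun k => t k.+1 - t k)) telescope_sumr //.
      by rewrite t0 tn subr0.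
    + rewrite mem_filter; apply/andP; split; first exact/asboolP.
      apply/mapP; exists [set x | g x < t k.+1 <= g x + q x]%SET.
        by rewrite mem_enum.
      by apply/ffunP => x; rewrite !ffunE inE.
  - by move=> x; apply: t_onto; rewrite mem_cat map_f ?mem_enum.
  - move=> x; apply: t_onto; rewrite mem_cat; apply/orP; right.
    by apply/mapP; exists x; rewrite ?mem_enum.
move=> m m_gt0 p [q Pq <-{p}] p_int.
have [lo] := P_layers q Pq; set g := fun x => _ => -[h_le1 P_layer].
have q_ge0 := P_ge0 q Pq.
have m_neq0 : m%:R != 0 :> R by rewrite pnatr_eq0 -lt0n.
pose t (k : nat) : R := k%:R / m%:R.
have t_mono a b : (a <= b <= m)%N -> t a <= t b.
  by case/andP=> le_ab _; rewrite ler_wpM2r ?invr_ge0 ?ler0n ?ler_nat.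
(* A sum of coordinates of [q] that lies in [0, 1] is a multiple of [1/m]. *)
have t_onto (c : seq I) : \sum_(y <- c) q y <= 1 ->
    exists2 j, (j <= m)%N & \sum_(y <- c) q y = t j.
  move=> c_le1; have c_ge0 : 0 <= \sum_(y <- c) q y by apply: sumr_ge0.
  have : m%:R * \sum_(y <- c) q y \is a Num.nat.
    rewrite natrEint mulr_ge0 ?ler0n // andbT mulr_sumr rpred_sum // => y _.
    by have := p_int y; rewrite ffunE.
  case/natrP=> j jE; exists j.
    by rewrite -(ler_nat R) -jE ler_piMr ?ler0n.
  by rewrite /t -jE mulrC mulKf.
have g_le1 x : g x <= 1 by rewrite (le_trans _ (h_le1 x)) ?lerDl.
exists (fun k : 'I_m => layer g q (t k.+1)); split.
  by move=> k; split; [exact: P_layer | exact: lattice_point_layer].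
rewrite {1}(layer_decomposition (g := g) t_mono q_ge0).
- rewrite scaler_sumr; apply: eq_bigr => k _.
  rewrite scalerA -mulrBl -natrB // subSnn mul1r.
  by rewrite divff // scale1r.
- by move=> x; exact: t_onto (g_le1 x).
- move=> x; have := t_onto (x :: lo x).
  by rewrite big_cons addrC; apply; apply: h_le1.
Qed.

End Layers.

Section PosetPolytopes.
Variables (R : realType) (d : Order.disp_t) (T : finPOrderType d).
Implicit Types (q : {ffun T -> R^o}) (x y : T).

Lemma comb_ffunE n (a : 'I_n -> R) (v : 'I_n -> {ffun T -> R^o}) x :
  (\sum_k a k *: v k) x = \sum_k a k * v k x.
Proof. by rewrite sum_ffunE; apply: eq_bigr => k _; rewrite ffunE. Qed.

Lemma normal_order_polytope : normal_polytope (order_polytope R T).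
Proof.
apply: normal_of_layers => [n a v a_ge0 a_sum Pv|q []//|q [q_ge0 q_le1 q_mono]].
  split=> [x|x|x y lt_yx]; rewrite ?comb_ffunE.
  - by apply: sumr_ge0 => k _; case: (Pv k) => v_ge0 _ _; apply: mulr_ge0.
  - rewrite -a_sum; apply: ler_sum => k _.
    by case: (Pv k) => _ v_le1 _; apply: ler_piMr.
  - apply: ler_sum => k _; apply: ler_wpM2l => //.
    by case: (Pv k) => _ _; apply.
exists (fun=> [::]); split=> [x|t]; first by rewrite big_nil add0r.
split=> [x|x|x y lt_yx]; rewrite !ffunE ?big_nil ?add0r ?ler0n ?lern1 ?leq_b1 //.
rewrite ler_nat; case: (0 < t) => //=.
by case: (leP t (q y)) => // /le_trans -> //; apply: q_mono.
Qed.

Lemma gt_trans : transitive (>%O : rel T).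
Proof. by move=> y x z lt_yx lt_zy; apply: lt_trans lt_zy lt_yx. Qed.

(** A finite maximum, because a chain has no repetition. *)
Lemma heaviest_chain_below q x :
  exists2 c, path >%O x c &
    forall c', path >%O x c' -> \sum_(y <- c') q y <= \sum_(y <- c) q y.
Proof.
have short c : path >%O x c -> (size c <= #|T|)%N.
  move=> xc; apply: ltnW; rewrite -[(size c).+1]/(size (x :: c)).
  have /card_uniqP <- : uniq (x :: c); last exact: max_card.
  exact: (sorted_uniq gt_trans (@ltxx _ T) (s := x :: c)) xc.
pose w (c : #|T|.-bseq T) : R := \sum_(y <- c) q y.
pose c0 : #|T|.-bseq T := [bseq].
have c0P : path >%O x c0 by [].
case: (@arg_maxP _ _ _ c0 (fun c => path >%O x c) w c0P) => c cP c_max.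
exists (c : seq T) => // c' c'P.
exact: (c_max (Bseq (short _ c'P)) c'P).
Qed.

(** A chain meets an antichain in at most one point. *)
Lemma antichain_chain_polytope (A : pred T) :
  (forall x y, (y < x)%O -> A x -> ~~ A y) ->
  chain_polytope R T [ffun x => (A x)%:R].
Proof.
move=> A_anti; split=> [x|]; first by rewrite ffunE ler0n.
elim=> [|x c IHc] xc; first by rewrite big_nil ler01.
rewrite big_cons ffunE; case: (boolP (A x)) => [Ax|_]; last first.
  by rewrite add0r; apply/IHc/path_sorted/xc.
rewrite big_seq big1 ?addr0 // => y yc.
have /allP/(_ y yc) lt_yx := order_path_min gt_trans xc.
by rewrite ffunE (negPf (A_anti _ _ lt_yx Ax)).
Qed.

Lemma normal_chain_polytope : normal_polytope (chain_polytope R T).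
Proof.
apply: normal_of_layers => [n a v a_ge0 a_sum Pv|q []//|q [q_ge0 q_le1]].
  split=> [x|c c_sorted].
    rewrite comb_ffunE; apply: sumr_ge0 => k _.
    by case: (Pv k) => v_ge0 _; apply: mulr_ge0.
  under eq_bigr do rewrite comb_ffunE.
  rewrite exchange_big /= -a_sum; apply: ler_sum => k _.
  by rewrite -mulr_sumr; case: (Pv k) => _ v_le1; apply: ler_piMr; auto.
have /choice[lo loP] x : exists c, path >%O x c /\
    forall c', path >%O x c' -> \sum_(y <- c') q y <= \sum_(y <- c) q y.
  by have [c] := heaviest_chain_below q x; exists c.
exists lo => /=; split=> [x|t].
  by have := q_le1 (x :: lo x) (loP x).1; rewrite big_cons addrC.
apply: antichain_chain_polytope => x y lt_yx /andP[lt_t _].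
rewrite negb_and -ltNge; apply/orP; right; apply: le_lt_trans lt_t.
have := (loP x).2 (y :: lo y); rewrite big_cons addrC; apply => /=.
by rewrite lt_yx (loP y).1.
Qed.

End PosetPolytopes.

Local Close Scope ring_scope.
Local Close Scope classical_set_scope.

Theorem corollary1p9 (R : realType) (n i : nat) (ell : i.-tuple nat)
    (i_bounds : 1 <= i <= n)
    (ell_bounds : forall k : 'I_i, i.-1 <= tnth ell k <= n)
    (ell_ascending : forall k1 k2 : 'I_i, k1 <= k2 -> tnth ell k1 <= tnth ell k2) :
  normal_polytope (order_polytope R (poset_ell n ell)) /\
  normal_polytope (chain_polytope R (poset_ell n ell)).
Proof. by split; [apply: normal_order_polytope | apply: normal_chain_polytope]. Qed.
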